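(* For $(m,n,b)\in\mathbb{R}^3$ let $\Phi_{b,m,n}\colon \mathrm{Sym}_3\to\mathrm{Sym}_3$ be the linear map sending the symmetric matrix $Z=[z_{ij}]_{i,j=0}^2$ to $$\Phi_{b,m,n}(Z)=b\begin{bmatrix} z_{11}&0&-z_{02}\\ 0&z_{22}&-z_{12}\\ -z_{02}&-z_{12}&z_{00}+z_{22}\end{bmatrix}+W,$$ where $W=[w_{ij}]_{i,j=0}^2$ is the symmetric matrix with entries $$\begin{aligned} w_{00}&=n^2(z_{00}+2mz_{01}+m^2z_{11}),\\ w_{01}&=w_{10}=-mn\left(nz_{00}+(mn-1)z_{01}-mz_{11}\right),\\ w_{02}&=w_{20}=-n(m+n)(z_{02}+mz_{12}),\\ w_{11}&=m^2(n^2z_{00}-2nz_{01}+z_{11}),\\ w_{12}&=w_{21}=m(m+n)(nz_{02}-z_{12}),\\ w_{22}&=(m+n)^2z_{22}. \end{aligned}$$ Let $$\mathcal{A}=\left\{(m,n,b)\in[-1,1]^2\times[0,1/4]\colon 0\le b\le\min\{-(2mn+n^2+m^2n^2),\,-(2mn+m^2n^2+m^2)\}\right\}.$$ Then $\Phi_{b,m,n}$ is positive for every $(m,n,b)\in\mathcal{A}$. For $(m,n,b)\in\mathcal{A}$, the map $\Phi_{b,m,n}$ is completely positive if $b=0$, and not completely positive if $b\neq 0$. Moreover, for every $(m,n,b)\in\mathcal{A}$ with $b=\min\{-(2mn+n^2+m^2n^2),\,-(2mn+m^2n^2+m^2)\}$, the map $\Phi_{b,m,n}$ is an extremal positive map.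
   Context: $\mathrm{Sym}_3$ is the space of real symmetric $3\times 3$ matrices; rows and columns are indexed by $0,1,2$. A linear map $\Phi\colon \mathrm{Sym}_3\to \mathrm{Sym}_3$ is positive if it maps positive semidefinite matrices to positive semidefinite matrices. It is completely positive if there exist $l\in\mathbb{N}$ and real $3\times 3$ matrices $B_1,\dots,B_l$ with $\Phi(xx^T)=\sum_{i=1}^l B_i xx^T B_i^T$ for all $x\in\mathbb{R}^3$; equivalently, the biquadratic form $y^T\Phi(xx^T)y$ in $x,y\in\mathbb{R}^3$ is a sum of squares of bilinear forms. A positive map on $\mathrm{Sym}_3$ is extremal if it cannot be written as a sum of two linearly independent positive maps $\mathrm{Sym}_3\to\mathrm{Sym}_3$. *)

(* Defs.v *)
From HB Require Import structures.
From mathcomp Require Import all_boot all_order all_algebra.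
From mathcomp Require Import reals ring.

Set Implicit Arguments.
Unset Strict Implicit.
Unset Printing Implicit Defensive.

Import Order.TTheory GRing.Theory Num.Theory.
Local Open Scope ring_scope.

Section SymmetricMatrices.
Variable R : realType.

Definition symv (n : nat) : {vspace 'M[R]_n} := fixedSpace (linfun (@trmx R n n)).

(* As [Sym n] is a vectType, ['End(Sym n)] is the vector space of linear maps
   on symmetric matrices, with the library's linear independence [free]. *)
Definition Sym (n : nat) := subvs_of (symv n).

Lemma symvE n (A : 'M[R]_n) : (A \in symv n) = (A^T == A).
Proof. by apply/fixedSpaceP/eqP; rewrite lfunE. Qed.

Lemma outer_sym n (x : 'cV[R]_n) : x *m x^T \in symv n.
Proof. by rewrite symvE trmx_mul trmxK. Qed.

Definition outer n (x : 'cV[R]_n) : Sym n := Subvs (outer_sym x).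

Definition psdmx n (A : 'M[R]_n) : Prop :=
  forall x : 'cV[R]_n, 0 <= (x^T *m A *m x) 0 0.

Definition positive_map n (Phi : 'End(Sym n)) : Prop :=
  forall Z : Sym n, psdmx (vsval Z) -> psdmx (vsval (Phi Z)).

Definition completely_positive n (Phi : 'End(Sym n)) : Prop :=
  exists (l : nat) (B : 'I_l -> 'M[R]_n), forall x : 'cV[R]_n,
    vsval (Phi (outer x)) = \sum_(i < l) B i *m (x *m x^T) *m (B i)^T.

Definition extremal_positive n (Phi : 'End(Sym n)) : Prop :=
  positive_map Phi /\
  ~ exists Phi1 Phi2 : 'End(Sym n),
      [/\ positive_map Phi1, positive_map Phi2, free [:: Phi1; Phi2]
        & Phi = Phi1 + Phi2].

End SymmetricMatrices.

Section TheMaps.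
Variable R : realType.
Implicit Types (b m n : R) (Z : 'M[R]_3).

Definition mx3 (s : seq (seq R)) : 'M[R]_3 := \matrix_(i, j) (nth [::] s i)`_j.

(* Only the upper triangular entries of [Z] are read. *)
Definition Phi_mx b m n Z : 'M[R]_3 :=
  let z00 := Z 0 0 in let z01 := Z 0 1 in let z02 := Z 0 2 in
  let z11 := Z 1 1 in let z12 := Z 1 2 in let z22 := Z 2 2 in
  let w00 := n ^+ 2 * (z00 + 2 * m * z01 + m ^+ 2 * z11) in
  let w01 := - (m * n) * (n * z00 + (m * n - 1) * z01 - m * z11) in
  let w02 := - n * (m + n) * (z02 + m * z12) in
  let w11 := m ^+ 2 * (n ^+ 2 * z00 - 2 * n * z01 + z11) in
  let w12 := m * (m + n) * (n * z02 - z12) in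
  let w22 := (m + n) ^+ 2 * z22 in
  b *: mx3 [:: [:: z11;   0;     - z02];
               [:: 0;     z22;   - z12];
               [:: - z02; - z12; z00 + z22]]
  + mx3 [:: [:: w00; w01; w02];
            [:: w01; w11; w12];
            [:: w02; w12; w22]].

Lemma Phi_mx_sym b m n Z : Phi_mx b m n Z \in symv R 3.
Proof.
rewrite symvE; apply/eqP/matrixP => i j; rewrite !mxE.
by case: i => [[|[|[|//]]] ?]; case: j => [[|[|[|//]]] ?].
Qed.

Definition Phi_fun b m n (Z : Sym R 3) : Sym R 3 :=
  Subvs (Phi_mx_sym b m n (vsval Z)).

Lemma Phi_fun_is_linear b m n : linear (Phi_fun b m n).
Proof.
move=> a Z Z'; apply: val_inj; rewrite /= linearP /=.
move: (vsval Z) (vsval Z') => {Z Z'} A B.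
apply/matrixP => i j; rewrite !mxE.
case: i => [[|[|[|//]]] ?]; case: j => [[|[|[|//]]] ?] /=; ring.
Qed.

HB.instance Definition _ b m n :=
  GRing.isLinear.Build R (Sym R 3) (Sym R 3) *:%R (Phi_fun b m n)
    (Phi_fun_is_linear b m n).

Definition Phi b m n : 'End(Sym R 3) := linfun (Phi_fun b m n).

Lemma PhiE b m n (Z : Sym R 3) : vsval (Phi b m n Z) = Phi_mx b m n (vsval Z).
Proof. by rewrite lfunE. Qed.

Definition bmax m n : R :=
  Num.min (- (2 * m * n + n ^+ 2 + m ^+ 2 * n ^+ 2))
          (- (2 * m * n + m ^+ 2 * n ^+ 2 + m ^+ 2)).

Definition in_calA m n b : bool :=
  [&& -1 <= m <= 1, -1 <= n <= 1, 0 <= b <= 1 / 4 & 0 <= b <= bmax m n].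

End TheMaps.

(* Main.v *)
Require Import Defs.
From mathcomp Require Import all_boot all_order all_algebra.
From mathcomp Require Import reals.
From mathcomp Require Import ring lra.

(** Everything is read off the biquadratic form
      F(x, y) = y^T Phi(x x^T) y = b Q(x, y) + L(x, y)^2
    ([biform], [Phi_biform]), where L is a bilinear form and Q does not depend
    on the parameters.

    Positivity.  A positive semidefinite matrix is a sum of squares w w^T
    ([psd_sum_outer]), so it suffices that F >= 0 ([biform_ge0]).  Exchanging x
    with y and the indices 0 and 1 exchanges m and n, so m^2 <= n^2 may be
    assumed; F is affine in b and is the square L^2 at b = 0, so b may be taken
    at the upper bound - (2mn + n^2 + m^2n^2).  Then F is a quadratic form in x
    whose first two leading minors are positive, outside easy degenerate y, and
    whose determinant is b^2 times a quadratic polynomial in s = y2^2.  The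
    discriminant of the latter is, up to the factor 1 - n^2 >= 0, a square times
    the product of two linear forms in (y0, m y1); where that product is
    positive, the coefficient of s is nonnegative, which reduces to the
    nonnegativity of a binary cubic ([cubic_ge0], [trinomial_ge0]).

    Complete positivity.  At b = 0 one square remains.  If F is a sum of squares
    of bilinear forms, each of them vanishes at the real zeros of F.  The zeros
    x = y = (+-1, +-1, 1) make its coefficients at x1 y2 and x2 y1 opposite, and
    the zero (e1, e2) kills the first of these; hence F(e2, e1) = b is zero.

    Extremality.  Let Phi be the sum of two positive maps, and let f be the form
    of one of them, so 0 <= f <= F.  Then f vanishes with its gradient at every
    zero of F.  Eight zeros, namely (+-1, +-1, 1) paired with itself, (e1, e2),
    (e2, e0), (e0, (m, 1, 0)) and ((1, n, 0), e1), cut the 36 coefficients of f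
    down to two parameters ([odd_coefs0], [even_coefs]), the dimension of the
    span of Q and L^2.  When b is maximal, F is of order t^4 along a line
    through (e2, e0) or (e1, e2), so the coefficient of t^2 in f vanishes too,
    and this last equation makes f a multiple of F ([biform_face]); when the
    maximal b is 0, the zero (e2, e1) of the square L^2 takes its place.  All
    this needs mn <> 0, but mn = 0 forces m = n = b = 0 and Phi = 0
    ([calA_degenerate]). *)

Set Implicit Arguments.
Unset Strict Implicit.
Unset Printing Implicit Defensive.

Import Order.TTheory GRing.Theory Num.Theory.
Local Open Scope ring_scope.

(** * Nonnegativity of the biquadratic form *)

Section Biform.
Variable R : realType.
Implicit Types b m n : R.

Definition biform b m n (x0 x1 x2 y0 y1 y2 : R) : R :=
  b * (x1 ^+ 2 * y0 ^+ 2 + x2 ^+ 2 * y1 ^+ 2 + (x0 ^+ 2 + x2 ^+ 2) * y2 ^+ 2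
       - 2 * x0 * x2 * y0 * y2 - 2 * x1 * x2 * y1 * y2)
  + (n * (x0 + m * x1) * y0 - m * (n * x0 - x1) * y1 - (m + n) * x2 * y2) ^+ 2.

(** The symmetry that exchanges the two bounds on [b]. *)
Lemma biform_swap b m n x0 x1 x2 y0 y1 y2 :
  biform b m n x0 x1 x2 y0 y1 y2 = biform b n m y1 y0 y2 x1 x0 x2.
Proof. by rewrite /biform; ring. Qed.

(** Sylvester's criterion in the form needed here: completing squares twice,
    the last coefficient being only required to be nonnegative. *)
Lemma quad_form3_ge0 (A B C D E F x y z : R) :
  0 < A -> 0 < A * D - B ^+ 2 ->
  0 <= A * (D * F - E ^+ 2) - B * (B * F - E * C) + C * (B * E - D * C) ->
  0 <= A * x ^+ 2 + D * y ^+ 2 + F * z ^+ 2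
       + 2 * B * x * y + 2 * C * x * z + 2 * E * y * z.
Proof.
move=> A0 M0 det0.
rewrite -(pmulr_rge0 _ A0) -(pmulr_rge0 _ M0).
set det := (X in 0 <= X) in det0.
have -> : (A * D - B ^+ 2) * (A * (A * x ^+ 2 + D * y ^+ 2 + F * z ^+ 2
       + 2 * B * x * y + 2 * C * x * z + 2 * E * y * z)) =
  (A * D - B ^+ 2) * (A * x + B * y + C * z) ^+ 2
  + ((A * D - B ^+ 2) * y + (A * E - B * C) * z) ^+ 2
  + A * det * z ^+ 2 by rewrite /det; ring.
by rewrite !addr_ge0 // ?sqr_ge0 // mulr_ge0 ?sqr_ge0 ?(ltW M0) // mulr_ge0 // ltW.
Qed.

Lemma disc_quad_ge0 (al be ga s : R) :
  0 <= al -> 0 <= ga -> 0 <= s ->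
  be ^+ 2 - 4 * al * ga <= 0 \/ 0 <= be ->
  0 <= al * s ^+ 2 + be * s + ga.
Proof.
move=> al0 ga0 s0 [disc|be0]; last first.
  by rewrite !addr_ge0 // mulr_ge0 // ?sqr_ge0.
have [al_eq0|al_neq0] := eqVneq al 0.
  move: disc; rewrite al_eq0 mulr0 mul0r subr0 => be0.
  have : be ^+ 2 == 0 by rewrite eq_le be0 sqr_ge0.
  by rewrite expf_eq0 /= => /eqP ->; rewrite !mul0r !add0r.
have al_gt0 : 0 < 4 * al by rewrite mulr_gt0 // lt_neqAle eq_sym al_neq0.
rewrite -(pmulr_rge0 _ al_gt0).
have -> : 4 * al * (al * s ^+ 2 + be * s + ga)
  = (2 * al * s + be) ^+ 2 - (be ^+ 2 - 4 * al * ga) by ring.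
by rewrite subr_ge0 (le_trans disc) ?sqr_ge0.
Qed.

(** The expression is affine in [M], so only [M = 0] and [M = k ^+ 2] matter.
    At both ends it becomes manifestly nonnegative when written in the two
    linear forms assumed to be nonnegative; the second one is then a binary
    cubic all of whose coefficients are nonnegative for [k] in [0, 1]. *)
Lemma cubic_ge0 (k M U W : R) : 0 <= k <= 1 -> 0 <= M <= k ^+ 2 ->
  0 <= (1 - k) * U + 2 * W -> 0 <= (1 + k) * U - 2 * W ->
  0 <= k ^+ 2 * (- 2 * W ^+ 2 * U + 2 * k * W * U ^+ 2 + (1 - k ^+ 2) * U ^+ 3)
       + M * (2 * k * W ^+ 3 - (1 + k ^+ 2) * W ^+ 2 * U).
Proof.
move=> /andP[k0 k1] /andP[M0 Mk].
set p := (X in 0 <= X -> _); set q := (X in _ -> 0 <= X -> _) => p0 q0.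
have U0 : 0 <= U by move: p0 q0; rewrite /p /q; lra.
set E0 := (X in k ^+ 2 * X); set E1 := (X in M * X).
have E0_ge0 : 0 <= E0.
  have -> : E0 = U * (p * q + (1 - k) * (1 + k) * U ^+ 2) / 2.
    by rewrite /E0 /p /q; field.
  have U2 := sqr_ge0 U.
  by rewrite divr_ge0 // mulr_ge0 // addr_ge0 // mulr_ge0 // mulr_ge0; lra.
have E01_ge0 : 0 <= E0 + E1.
  have -> : E0 + E1 = ((1 + k) * (1 - k) ^+ 2 * p ^+ 3
    + (1 - k) * (15 + 9 * k + k * (1 - k)) * p ^+ 2 * q
    + (1 + k) * (4 + 11 * (1 - k) + k * (1 - k)) * p * q ^+ 2
    + (1 - k) * (1 + k) ^+ 2 * q ^+ 3) / 32.
    by rewrite /E0 /E1 /p /q; field.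
  have kk : 0 <= k * (1 - k) by rewrite mulr_ge0 //; lra.
  have p2 := sqr_ge0 p; have q2 := sqr_ge0 q.
  have [p3 q3] : 0 <= p ^+ 3 /\ 0 <= q ^+ 3 by rewrite !exprn_ge0.
  rewrite divr_ge0 // !addr_ge0 // ?mulr_ge0 ?sqr_ge0 //; lra.
have -> : k ^+ 2 * E0 + M * E1 = (k ^+ 2 - M) * E0 + M * (E0 + E1) by ring.
by rewrite addr_ge0 // mulr_ge0 // subr_ge0.
Qed.

Lemma pos_mul_add_ge0 (p q : R) : 0 < p * q -> 0 <= p + q -> 0 <= p /\ 0 <= q.
Proof.
move=> pq s; have [p0|p0] := ltP p 0; last first.
  have [//|q0] := leP 0 q; by move: (mulr_ge0_le0 p0 (ltW q0)); rewrite leNgt pq.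
have q0 : 0 <= q by lra.
by move: (mulr_le0_ge0 (ltW p0) q0); rewrite leNgt pq.
Qed.

(** Up to the factor b^2, this is the determinant of [biform] as a quadratic form
    in x, with s = y2^2 and b equal to its bound - (2mn + n^2 + m^2n^2). *)
Lemma trinomial_ge0 m n (y0 y1 s : R) : m ^+ 2 <= n ^+ 2 -> n ^+ 2 <= 1 -> 0 <= s ->
  0 <= (m ^+ 2 * y0 ^+ 2 - 2 * m * n ^+ 2 * y0 * y1
        + (n ^+ 2 - m ^+ 2 + m ^+ 2 * n ^+ 2) * y1 ^+ 2) * s ^+ 2
     + (2 * m * n ^+ 2 * y0 ^+ 3 * y1
        - (m ^+ 2 + 2 * n ^+ 2 + m ^+ 2 * n ^+ 2) * y0 ^+ 2 * y1 ^+ 2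
        + 2 * m * n ^+ 2 * y0 * y1 ^+ 3 + m ^+ 2 * (1 - n ^+ 2) * y1 ^+ 4) * s
     + n ^+ 2 * y0 ^+ 2 * y1 ^+ 2 * (y0 - m * y1) ^+ 2.
Proof.
move=> mn n1 s0.
set al := (X in X * s ^+ 2 + _ + _); set be := (X in _ + X * s + _).
set ga := (X in _ + X).
have ga_ge0 : 0 <= ga.
  have -> : ga = (n * y0 * y1 * (y0 - m * y1)) ^+ 2 by rewrite /ga; ring.
  exact: sqr_ge0.
have n1' : 0 <= 1 - n ^+ 2 by rewrite subr_ge0.
have m2 := sqr_ge0 m.
have [m_eq0|m_neq0] := eqVneq m 0.
  apply: disc_quad_ge0 => //; [|left].
  - have -> : al = n ^+ 2 * y1 ^+ 2 by rewrite /al m_eq0; ring.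
    by rewrite mulr_ge0 ?sqr_ge0.
  - suff -> : be ^+ 2 - 4 * al * ga = 0 by [].
    by rewrite /be /al /ga m_eq0; ring.
have m_gt0 : 0 < m ^+ 2 by rewrite exprn_even_gt0.
have n_gt0 : 0 < n ^+ 2 by rewrite (lt_le_trans m_gt0).
have k2 : `|n| ^+ 2 = n ^+ 2 by rewrite real_normK ?num_real.
set k := `|n| in k2.
have k01 : 0 <= k <= 1 by rewrite normr_ge0 /= -(@expr_le1 _ 2%N k) ?normr_ge0 // k2.
have al_ge0 : 0 <= al.
  rewrite -(pmulr_rge0 _ m_gt0).
  have -> : m ^+ 2 * al = (m ^+ 2 * y0 - m * n ^+ 2 * y1) ^+ 2
     + (1 - n ^+ 2) * (n ^+ 2 - m ^+ 2) * (m * y1) ^+ 2 by rewrite /al; ring.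
  by rewrite addr_ge0 ?sqr_ge0 // mulr_ge0 ?sqr_ge0 // mulr_ge0 // subr_ge0.
apply: disc_quad_ge0 => //.
(* [p * q] is the factor of the discriminant that can change sign. *)
set U := m * y1; set W := k * y0.
set p := (1 - k) * U + 2 * W; set q := (1 + k) * U - 2 * W.
have disc : be ^+ 2 - 4 * al * ga =
   (1 - n ^+ 2) * (m * y1 * (y0 ^+ 2 - y1 ^+ 2)) ^+ 2 * (p * q).
  by rewrite /al /be /ga /p /q /U /W -k2; ring.
have [pq|pq] := leP (p * q) 0.
  by left; rewrite disc mulr_ge0_le0 // mulr_ge0 ?sqr_ge0.
right; rewrite -(pmulr_rge0 _ n_gt0) -(pmulr_rge0 _ m_gt0).
have Mk : 0 <= m ^+ 2 <= k ^+ 2 by rewrite k2 m2.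
have beE : m ^+ 2 * (n ^+ 2 * be) = U *
  (k ^+ 2 * (- 2 * W ^+ 2 * U + 2 * k * W * U ^+ 2 + (1 - k ^+ 2) * U ^+ 3)
       + m ^+ 2 * (2 * k * W ^+ 3 - (1 + k ^+ 2) * W ^+ 2 * U)).
  by rewrite /be /U /W -k2; ring.
rewrite beE.
(* [p + q = 2 * U], and changing the sign of [y] changes those of [U] and [W]. *)
have [U0|U0] := leP 0 U.
  have [p0 q0] : 0 <= p /\ 0 <= q.
    by apply: pos_mul_add_ge0 => //; rewrite /p /q; lra.
  by rewrite mulr_ge0 // cubic_ge0.
have [p0 q0] : 0 <= - p /\ 0 <= - q.
  by apply: pos_mul_add_ge0; rewrite ?mulrNN // /p /q; lra.
have := @cubic_ge0 k (m ^+ 2) (- U) (- W) k01 Mk.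
rewrite /p in p0; rewrite /q in q0.
have -> : (1 - k) * - U + 2 * - W = - ((1 - k) * U + 2 * W) by ring.
have -> : (1 + k) * - U - 2 * - W = - ((1 + k) * U - 2 * W) by ring.
move=> /(_ p0 q0); set e := (X in 0 <= X) => e0.
set d := (X in 0 <= _ * X).
have -> : U * d = - U * e by rewrite /d /e; ring.
by rewrite mulr_ge0 // oppr_ge0 ltW.
Qed.

Lemma biform_bmax_ge0 b m n x0 x1 x2 y0 y1 y2 : m ^+ 2 <= n ^+ 2 -> n ^+ 2 <= 1 ->
  b = - (2 * m * n + n ^+ 2 + m ^+ 2 * n ^+ 2) -> 0 < b ->
  0 <= biform b m n x0 x1 x2 y0 y1 y2.
Proof.
move=> mn n1 bE b0.
have [y2_0|y2_neq0] := eqVneq y2 0.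
  have -> : biform b m n x0 x1 x2 y0 y1 y2 = b * ((x1 * y0) ^+ 2 + (x2 * y1) ^+ 2)
    + (n * (x0 + m * x1) * y0 - m * (n * x0 - x1) * y1) ^+ 2.
    by rewrite /biform y2_0; ring.
  by rewrite addr_ge0 ?sqr_ge0 // mulr_ge0 ?(ltW b0) // addr_ge0 ?sqr_ge0.
have y2_gt0 : 0 < y2 ^+ 2 by rewrite exprn_even_gt0.
pose A := n * (y0 - m * y1); pose C := m * (n * y0 + y1); pose E := - (m + n) * y2.
have [y0C|y0C] := boolP ((y0 == 0) && (C == 0)).
  move: y0C => /andP[/eqP y0_0 /eqP C0].
  have y1_0 : y1 = 0.
    move: C0; rewrite /C y0_0 mulr0 add0r => /eqP; rewrite mulf_eq0.
    case/orP=> [/eqP m0|/eqP //].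
    by exfalso; move: b0; rewrite bE m0; have := sqr_ge0 n; lra.
  have -> : biform b m n x0 x1 x2 y0 y1 y2
    = b * ((x0 * y2) ^+ 2 + (x2 * y2) ^+ 2) + ((m + n) * x2 * y2) ^+ 2.
    by rewrite /biform y0_0 y1_0; ring.
  by rewrite addr_ge0 ?sqr_ge0 // mulr_ge0 ?(ltW b0) // addr_ge0 ?sqr_ge0.
have -> : biform b m n x0 x1 x2 y0 y1 y2 =
  (b * y2 ^+ 2 + A ^+ 2) * x0 ^+ 2 + (b * y0 ^+ 2 + C ^+ 2) * x1 ^+ 2
  + (b * (y1 ^+ 2 + y2 ^+ 2) + E ^+ 2) * x2 ^+ 2 + 2 * (A * C) * x0 * x1
  + 2 * (A * E - b * y0 * y2) * x0 * x2 + 2 * (C * E - b * y1 * y2) * x1 * x2.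
  by rewrite /biform /A /C /E; ring.
have P0 : 0 < b * y2 ^+ 2 + A ^+ 2 by rewrite ltr_wpDr ?sqr_ge0 // mulr_gt0.
apply: quad_form3_ge0.
- exact: P0.
- have -> : (b * y2 ^+ 2 + A ^+ 2) * (b * y0 ^+ 2 + C ^+ 2) - (A * C) ^+ 2
     = b * ((b * y2 ^+ 2 + A ^+ 2) * y0 ^+ 2 + (y2 * C) ^+ 2) by ring.
  rewrite mulr_gt0 //; move: y0C; have [-> /= C0|y0_neq0 _] := eqVneq y0 0.
    by rewrite expr0n mulr0 add0r exprn_even_gt0 //= mulf_neq0.
  by rewrite ltr_wpDr ?sqr_ge0 // mulr_gt0 // exprn_even_gt0.
set det := (X in 0 <= X).
have -> : det = b ^+ 2 * (
   (m ^+ 2 * y0 ^+ 2 - 2 * m * n ^+ 2 * y0 * y1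
            + (n ^+ 2 - m ^+ 2 + m ^+ 2 * n ^+ 2) * y1 ^+ 2) * (y2 ^+ 2) ^+ 2
   + (2 * m * n ^+ 2 * y0 ^+ 3 * y1
            - (m ^+ 2 + 2 * n ^+ 2 + m ^+ 2 * n ^+ 2) * y0 ^+ 2 * y1 ^+ 2
            + 2 * m * n ^+ 2 * y0 * y1 ^+ 3 + m ^+ 2 * (1 - n ^+ 2) * y1 ^+ 4)
     * y2 ^+ 2
   + n ^+ 2 * y0 ^+ 2 * y1 ^+ 2 * (y0 - m * y1) ^+ 2).
  by rewrite /det /A /C /E bE; ring.
by rewrite mulr_ge0 ?sqr_ge0 // trinomial_ge0 ?sqr_ge0.
Qed.

Lemma biform_ge0 m n b x0 x1 x2 y0 y1 y2 :
  in_calA m n b -> 0 <= biform b m n x0 x1 x2 y0 y1 y2.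
Proof.
move=> /and4P[m1 n1 _ /andP[b0]]; rewrite /bmax le_min => /andP[bn bm].
have sqr_le1 (c : R) : -1 <= c <= 1 -> c ^+ 2 <= 1.
  by move=> c1; rewrite -[leLHS]real_normK ?num_real // expr_le1 // ler_norml.
have [m2 n2] := (sqr_le1 m m1, sqr_le1 n n1).
wlog mn : m n x0 x1 x2 y0 y1 y2 bn bm m2 n2 {m1 n1} / m ^+ 2 <= n ^+ 2.
  move=> wl; have [mn|/ltW mn] := leP (m ^+ 2) (n ^+ 2); first exact: wl.
  by rewrite biform_swap; apply: wl => //; lra.
set c := (X in b <= X) in bn.
have c0 := le_trans b0 bn.
have [c_eq0|c_neq0] := eqVneq c 0.
  have -> : b = 0 by apply/eqP; rewrite eq_le b0 -c_eq0 bn.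
  by rewrite /biform mul0r add0r sqr_ge0.
have c_gt0 : 0 < c by rewrite lt_neqAle eq_sym c_neq0.
rewrite -(pmulr_rge0 _ c_gt0).
have -> : c * biform b m n x0 x1 x2 y0 y1 y2 =
  b * biform c m n x0 x1 x2 y0 y1 y2 + (c - b) *
  (n * (x0 + m * x1) * y0 - m * (n * x0 - x1) * y1 - (m + n) * x2 * y2) ^+ 2.
  by rewrite /biform; ring.
by rewrite addr_ge0 // mulr_ge0 ?sqr_ge0 ?subr_ge0 // biform_bmax_ge0.
Qed.

End Biform.

(** * Biquadratic forms dominated by it *)

Section Extremality.
Variable R : realType.
Implicit Types b m n : R.
Local Notation co a i j k l := (a i%N j%N k%N l%N) (only parsing).

Definition quad3 (c : nat -> nat -> R) (v0 v1 v2 : R) : R :=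
  c 0%N 0%N * v0 ^+ 2 + c 0%N 1%N * v0 * v1 + c 0%N 2%N * v0 * v2
  + c 1%N 1%N * v1 ^+ 2 + c 1%N 2%N * v1 * v2 + c 2%N 2%N * v2 ^+ 2.

(** [a i j k l], for [i <= j] and [k <= l], is the coefficient of the monomial
    x_i x_j y_k y_l. *)
Definition biquad (a : nat -> nat -> nat -> nat -> R) (x0 x1 x2 y0 y1 y2 : R) : R :=
  quad3 (fun i j => quad3 (a i j) y0 y1 y2) x0 x1 x2.

Lemma biquad_dual a x0 x1 x2 y0 y1 y2 :
  biquad a x0 x1 x2 y0 y1 y2
  = quad3 (fun k l => quad3 (fun i j => a i j k l) x0 x1 x2) y0 y1 y2.
Proof. by rewrite /biquad /quad3; ring. Qed.

Lemma linear_ge0_eq0 (p q : R) : (forall t, 0 <= p * t + q) -> p = 0.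
Proof.
move=> pq; apply/eqP; apply: contraT => p_neq0.
have := pq (- (q + 1) / p).
have -> : p * (- (q + 1) / p) + q = - 1 by field.
lra.
Qed.

(** A zero is a minimum, so the gradient vanishes there. *)
Lemma quad3_null c v0 v1 v2 :
  (forall u0 u1 u2, 0 <= quad3 c u0 u1 u2) -> quad3 c v0 v1 v2 = 0 ->
  [/\ 2 * c 0%N 0%N * v0 + c 0%N 1%N * v1 + c 0%N 2%N * v2 = 0,
      c 0%N 1%N * v0 + 2 * c 1%N 1%N * v1 + c 1%N 2%N * v2 = 0 &
      c 0%N 2%N * v0 + c 1%N 2%N * v1 + 2 * c 2%N 2%N * v2 = 0].
Proof.
move=> c_ge0 cv0.
have polar w0 w1 w2 : quad3 c (v0 + w0) (v1 + w1) (v2 + w2) - quad3 c w0 w1 w2 = 0.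
  apply: (@linear_ge0_eq0 _ (quad3 c w0 w1 w2)) => t.
  have := c_ge0 (t * v0 + w0) (t * v1 + w1) (t * v2 + w2).
  have -> : quad3 c (t * v0 + w0) (t * v1 + w1) (t * v2 + w2) =
    (quad3 c (v0 + w0) (v1 + w1) (v2 + w2) - quad3 c w0 w1 w2) * t
    + quad3 c w0 w1 w2 + (t ^+ 2 - t) * quad3 c v0 v1 v2.
    by rewrite /quad3; ring.
  by rewrite cv0 mulr0 addr0.
split.
- by have := polar 1 0 0; move: cv0; rewrite /quad3; lra.
- by have := polar 0 1 0; move: cv0; rewrite /quad3; lra.
- by have := polar 0 0 1; move: cv0; rewrite /quad3; lra.
Qed.

Lemma lead_ge0 (h k : R) :
  (forall t, 0 <= h * t ^+ 2 + k * t ^+ 4) -> 0 <= h.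
Proof.
move=> ge0; rewrite leNgt; apply/negP => h0.
(* small enough for [k * t ^+ 2] not to compensate [h] *)
pose t := - h / (`|k| - h + 1).
have d_gt0 : 0 < `|k| - h + 1 by have := normr_ge0 k; lra.
have t_gt0 : 0 < t by rewrite /t divr_gt0 // oppr_gt0.
have t_lt1 : t <= 1 by rewrite /t ler_pdivrMr //; have := normr_ge0 k; lra.
have kt : `|k| * t < - h.
  rewrite /t mulrA ltr_pdivrMr // -subr_gt0.
  have -> : - h * (`|k| - h + 1) - `|k| * - h = h ^+ 2 - h by ring.
  by have := sqr_ge0 h; lra.
have t2 : 0 < t ^+ 2 by rewrite exprn_gt0.
have : 0 <= h + k * t ^+ 2.
  rewrite -(pmulr_rge0 _ t2).
  by have -> : t ^+ 2 * (h + k * t ^+ 2) = h * t ^+ 2 + k * t ^+ 4 by ring.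
suff : k * t ^+ 2 <= `|k| * t by lra.
apply: le_trans (ler_wpM2r (sqr_ge0 t) (ler_norm k)) _.
by rewrite ler_wpM2l // expr2 ger_pMr.
Qed.

Definition swap_xy (a : nat -> nat -> nat -> nat -> R) i j k l := a k l i j.

Lemma biquad_tr a x0 x1 x2 y0 y1 y2 :
  biquad (swap_xy a) x0 x1 x2 y0 y1 y2 = biquad a y0 y1 y2 x0 x1 x2.
Proof. by rewrite biquad_dual. Qed.

Lemma biquad_null a x0 x1 x2 y0 y1 y2 :
  (forall u0 u1 u2 v0 v1 v2, 0 <= biquad a u0 u1 u2 v0 v1 v2) ->
  biquad a x0 x1 x2 y0 y1 y2 = 0 ->
  let c k l := quad3 (fun i j => a i j k l) x0 x1 x2 in
  [/\ 2 * c 0%N 0%N * y0 + c 0%N 1%N * y1 + c 0%N 2%N * y2 = 0,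
      c 0%N 1%N * y0 + 2 * c 1%N 1%N * y1 + c 1%N 2%N * y2 = 0 &
      c 0%N 2%N * y0 + c 1%N 2%N * y1 + 2 * c 2%N 2%N * y2 = 0].
Proof.
move=> a_ge0 a0 c; apply: quad3_null => [u0 u1 u2|]; rewrite -biquad_dual //.
Qed.

Definition nonneg_sign_null a :=
  (forall u0 u1 u2 v0 v1 v2, 0 <= biquad a u0 u1 u2 v0 v1 v2) /\
  (forall s t : bool, biquad a ((-1) ^+ s) ((-1) ^+ t) 1 ((-1) ^+ s) ((-1) ^+ t) 1 = 0).

(** As [x = y] at these zeros, computing the gradient in [y] is enough. *)
Lemma nonneg_sign_null_tr a : nonneg_sign_null a -> nonneg_sign_null (swap_xy a).
Proof. by case=> a_ge0 a0; split=> *; rewrite biquad_tr. Qed.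

(** At the zeros x = y = (+-1, +-1, 1) the gradient equations split according to
    the parity of the monomials: none of the indices 0, 1, 2 occurring an odd
    number of times, or exactly two of them, {0, 1}, {0, 2} or {1, 2}. *)
Lemma sign_fourier (A B C D : R) :
  (forall s t : bool,
     A + (-1) ^+ s * (-1) ^+ t * B + (-1) ^+ s * C + (-1) ^+ t * D = 0) ->
  [/\ A = 0, B = 0, C = 0 & D = 0].
Proof.
move=> h.
have := (h false false, h false true, h true false, h true true).
by rewrite !expr0 !expr1 => -[[[h1 h2] h3] h4]; split; lra.
Qed.

Lemma sign_grad0 a : nonneg_sign_null a ->
  [/\ 2 * (co a 0 0 0 0 + co a 1 1 0 0 + co a 2 2 0 0) + co a 0 1 0 1 + co a 0 2 0 2 = 0,
      2 * co a 0 1 0 0 + co a 0 0 0 1 + co a 1 1 0 1 + co a 2 2 0 1 + co a 1 2 0 2 = 0,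
      2 * co a 0 2 0 0 + co a 0 0 0 2 + co a 1 1 0 2 + co a 2 2 0 2 + co a 1 2 0 1 = 0 &
      2 * co a 1 2 0 0 + co a 0 2 0 1 + co a 0 1 0 2 = 0].
Proof.
case=> a_ge0 a0; apply: sign_fourier => s t.
have [g _ _] := biquad_null a_ge0 (a0 s t).
by move: g; rewrite /quad3; case: s t => [] [] /=; rewrite ?expr0 ?expr1; lra.
Qed.

Lemma sign_grad1 a : nonneg_sign_null a ->
  [/\ 2 * (co a 0 0 1 1 + co a 1 1 1 1 + co a 2 2 1 1) + co a 0 1 0 1 + co a 1 2 1 2 = 0,
      2 * co a 0 1 1 1 + co a 0 0 0 1 + co a 1 1 0 1 + co a 2 2 0 1 + co a 0 2 1 2 = 0,
      2 * co a 0 2 1 1 + co a 0 1 1 2 + co a 1 2 0 1 = 0 &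
      2 * co a 1 2 1 1 + co a 0 0 1 2 + co a 1 1 1 2 + co a 2 2 1 2 + co a 0 2 0 1 = 0].
Proof.
case=> a_ge0 a0; apply: sign_fourier => s t.
have [_ g _] := biquad_null a_ge0 (a0 s t).
by move: g; rewrite /quad3; case: s t => [] [] /=; rewrite ?expr0 ?expr1; lra.
Qed.

Lemma sign_grad2 a : nonneg_sign_null a ->
  [/\ 2 * (co a 0 0 2 2 + co a 1 1 2 2 + co a 2 2 2 2) + co a 0 2 0 2 + co a 1 2 1 2 = 0,
      2 * co a 0 1 2 2 + co a 0 2 1 2 + co a 1 2 0 2 = 0,
      2 * co a 0 2 2 2 + co a 0 0 0 2 + co a 1 1 0 2 + co a 2 2 0 2 + co a 0 1 1 2 = 0 &
      2 * co a 1 2 2 2 + co a 0 0 1 2 + co a 1 1 1 2 + co a 2 2 1 2 + co a 0 1 0 2 = 0].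
Proof.
case=> a_ge0 a0; apply: sign_fourier => s t.
have [_ _ g] := biquad_null a_ge0 (a0 s t).
by move: g; rewrite /quad3; case: s t => [] [] /=; rewrite ?expr0 ?expr1; lra.
Qed.

(** [biform] does not change when both x2 and y2 change sign, so a multiple of it
    can only involve monomials in which the index 2 occurs an even number of
    times; the gradient equations kill the coefficients of all others. *)
Lemma odd_coefs0 (a : nat -> nat -> nat -> nat -> R) : nonneg_sign_null a ->
  co a 0 2 0 0 = 0 -> co a 1 1 0 2 = 0 -> co a 2 2 0 2 = 0 ->
  co a 1 2 0 0 = 0 -> co a 1 1 1 2 = 0 -> co a 1 2 2 2 = 0 ->
  [/\ [/\ co a 0 0 0 2 = 0, co a 0 1 1 2 = 0 & co a 1 2 0 1 = 0],
      co a 0 2 1 1 = 0 /\ co a 0 2 2 2 = 0,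
      [/\ co a 0 0 1 2 = 0, co a 0 1 0 2 = 0 & co a 0 2 0 1 = 0] &
      co a 1 2 1 1 = 0 /\ co a 2 2 1 2 = 0].
Proof.
move=> an; have antr := nonneg_sign_null_tr an.
have [_ _ y0B y0C] := sign_grad0 an; have [_ _ x0B x0C] := sign_grad0 antr.
have [_ _ y1B y1C] := sign_grad1 an; have [_ _ x1B x1C] := sign_grad1 antr.
have [_ _ y2B y2C] := sign_grad2 an; have [_ _ x2B x2C] := sign_grad2 antr.
rewrite /swap_xy in x0B x0C x1B x1C x2B x2C.
move=> e1 e2 e3 e4 e5 e6.
have p0 : co a 0 0 0 2 = 0 by lra.
have q0 : co a 0 0 1 2 = 0 by lra.
have q1 : co a 0 1 0 2 = 0 by lra.
split; [split|split|split|split] => //; lra.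
Qed.

(** Among the monomials in which the index 2 occurs an even number of times, seven
    coefficients stay free, which the zeros depending on [m] and [n] will bring
    down to two. *)
Lemma even_coefs (a : nat -> nat -> nat -> nat -> R) : nonneg_sign_null a ->
  co a 2 2 0 0 = 0 -> co a 1 1 2 2 = 0 -> co a 0 1 2 2 = 0 -> co a 2 2 0 1 = 0 ->
  [/\ [/\ co a 0 1 0 0 = - co a 0 0 0 1, co a 0 1 1 1 = - co a 1 1 0 1,
          co a 0 2 1 2 = co a 1 1 0 1 - co a 0 0 0 1
        & co a 1 2 0 2 = co a 0 0 0 1 - co a 1 1 0 1],
      [/\ co a 2 2 1 1 = co a 0 0 2 2,
          co a 1 1 0 0 = co a 0 0 2 2 + co a 0 0 1 1 &
          co a 2 2 2 2 = co a 0 0 2 2 + co a 0 0 0 0 + 2 * co a 0 0 1 1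
                         + co a 1 1 1 1 + co a 0 1 0 1] &
      co a 0 2 0 2 = - 2 * (co a 0 0 0 0 + co a 0 0 1 1 + co a 0 0 2 2) - co a 0 1 0 1
      /\
      co a 1 2 1 2 = - 2 * (co a 0 0 1 1 + co a 1 1 1 1 + co a 0 0 2 2) - co a 0 1 0 1].
Proof.
move=> an; have antr := nonneg_sign_null_tr an.
have [y0A y0B _ _] := sign_grad0 an; have [x0A x0B _ _] := sign_grad0 antr.
have [y1A y1B _ _] := sign_grad1 an; have [x1A x1B _ _] := sign_grad1 antr.
have [y2A y2B _ _] := sign_grad2 an; have [x2A x2B _ _] := sign_grad2 antr.
rewrite /swap_xy in x0A x0B x1A x1B x2A x2B.
move=> e1 e2 e3 e4.
split; [split|split|split]; lra.
Qed.

(** The form spans an extreme ray of the cone of nonnegative biquadratic forms. *)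
Lemma biform_face b m n (a : nat -> nat -> nat -> nat -> R) :
  m != 0 -> n != 0 -> 0 <= b ->
  b = - (2 * m * n + n ^+ 2 + m ^+ 2 * n ^+ 2) \/
  b = - (2 * m * n + m ^+ 2 * n ^+ 2 + m ^+ 2) ->
  (forall x0 x1 x2 y0 y1 y2, 0 <= biquad a x0 x1 x2 y0 y1 y2
                               <= biform b m n x0 x1 x2 y0 y1 y2) ->
  exists la, forall x0 x1 x2 y0 y1 y2,
    biquad a x0 x1 x2 y0 y1 y2 = la * biform b m n x0 x1 x2 y0 y1 y2.
Proof.
move=> m0 n0 b0 bE dom.
have a_ge0 x0 x1 x2 y0 y1 y2 : 0 <= biquad a x0 x1 x2 y0 y1 y2.
  by have /andP[] := dom x0 x1 x2 y0 y1 y2.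
have null x0 x1 x2 y0 y1 y2 : biform b m n x0 x1 x2 y0 y1 y2 = 0 ->
    biquad a x0 x1 x2 y0 y1 y2 = 0.
  move=> F0; apply/eqP; rewrite eq_le a_ge0 andbT -F0.
  by have /andP[_ ->] := dom x0 x1 x2 y0 y1 y2.
have tr_ge0 x0 x1 x2 y0 y1 y2 : 0 <= biquad (swap_xy a) x0 x1 x2 y0 y1 y2.
  by rewrite biquad_tr.
have grad x0 x1 x2 y0 y1 y2 (F0 : biform b m n x0 x1 x2 y0 y1 y2 = 0) :=
  (biquad_null a_ge0 (null _ _ _ _ _ _ F0),
   biquad_null tr_ge0 (etrans (biquad_tr a y0 y1 y2 x0 x1 x2) (null _ _ _ _ _ _ F0))).
have an : nonneg_sign_null a.
  split=> // s t; apply: null; rewrite /biform.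
  by case: s t => [] [] /=; rewrite ?expr0 ?expr1; ring.
have z1 : biform b m n 0 1 0 0 0 1 = 0 by rewrite /biform; ring.
have z2 : biform b m n 0 0 1 1 0 0 = 0 by rewrite /biform; ring.
have z3 : biform b m n 1 0 0 m 1 0 = 0 by rewrite /biform; ring.
have z4 : biform b m n 1 n 0 0 1 0 = 0 by rewrite /biform; ring.
have [[a1102 a1112 a1122] [a0122 _ a1222]] := grad _ _ _ _ _ _ z1.
have [[a2200 a2201 a2202] [a0200 a1200 _]] := grad _ _ _ _ _ _ z2.
have [[z3y0 z3y1 _] _] := grad _ _ _ _ _ _ z3.
have [[z4y0 _ _] [z4x0 z4x1 _]] := grad _ _ _ _ _ _ z4.
have {}a1102 : co a 1 1 0 2 = 0 by move: a1102; rewrite /quad3; lra.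
have {}a1112 : co a 1 1 1 2 = 0 by move: a1112; rewrite /quad3; lra.
have {}a1122 : co a 1 1 2 2 = 0 by move: a1122; rewrite /quad3; lra.
have {}a0122 : co a 0 1 2 2 = 0 by move: a0122; rewrite /quad3 /swap_xy; lra.
have {}a1222 : co a 1 2 2 2 = 0 by move: a1222; rewrite /quad3 /swap_xy; lra.
have {}a2200 : co a 2 2 0 0 = 0 by move: a2200; rewrite /quad3; lra.
have {}a2201 : co a 2 2 0 1 = 0 by move: a2201; rewrite /quad3; lra.
have {}a2202 : co a 2 2 0 2 = 0 by move: a2202; rewrite /quad3; lra.
have {}a0200 : co a 0 2 0 0 = 0 by move: a0200; rewrite /quad3 /swap_xy; lra.
have {}a1200 : co a 1 2 0 0 = 0 by move: a1200; rewrite /quad3 /swap_xy; lra.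
have [[a0002 a0112 a1201] [a0211 a0222] [a0012 a0102 a0201] [a1211 a2212]] :=
  odd_coefs0 an a0200 a1102 a2202 a1200 a1112 a1222.
have [[a0100 a0111 a0212 a1202] [a2211 a1100 a2222] [a0202 a1212]] :=
  even_coefs an a2200 a1122 a0122 a2201.
have [la a0000] : exists la, co a 0 0 0 0 = n ^+ 2 * la.
  by exists (co a 0 0 0 0 / n ^+ 2); field.
have a0001 : co a 0 0 0 1 = - 2 * m * n ^+ 2 * la.
  by move: z3y0; rewrite /quad3 a0000; lra.
have a0011 : co a 0 0 1 1 = m ^+ 2 * n ^+ 2 * la.
  by move: z3y1; rewrite /quad3 a0001; lra.
have a1101 : co a 1 1 0 1 = 2 * m ^+ 2 * n * la.
  by apply: (mulfI n0); move: z4x0; rewrite /quad3 /swap_xy a0111 a0011; lra.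
have a1111 : co a 1 1 1 1 = m ^+ 2 * la.
  by apply: (mulfI n0); move: z4x1; rewrite /quad3 /swap_xy a0111 a1101; lra.
have a0101 : co a 0 1 0 1 = - 2 * m * n * (m * n - 1) * la.
  by apply: (mulfI n0); move: z4y0; rewrite /quad3 a0001 a1101; lra.
have subst_zero := (a0002, a0112, a1201, a0211, a0222, a0012, a0102, a0201, a1211,
  a2212, (a1102, a1112, a1122, a0122, a1222, a2200, a2201, a2202, a0200, a1200)).
have subst_even := (a2211, a1100, a2222, a0202, a1212, a0100, a0111, a0212, a1202).
have subst_la := (a0101, a1111, a1101, a0011, a0001, a0000).
have a0022 : co a 0 0 2 2 = b * la.
  (* At [b = 0] the form is a square and has further zeros. *)
  have [b_eq0|b_neq0] := eqVneq b 0.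
    have z5 : biform b m n 0 0 1 0 1 0 = 0 by rewrite /biform b_eq0; ring.
    by move: (null _ _ _ _ _ _ z5); rewrite /biquad /quad3 b_eq0; lra.
  pose h := b * (b * la - co a 0 0 2 2).
  suff : 0 <= h /\ 0 <= - h.
    rewrite oppr_ge0 => -[h1 h2]; apply/eqP; rewrite eq_sym -subr_eq0.
    move: (le_anti (introT andP (conj h2 h1))) => /eqP.
    by rewrite mulf_eq0 (negPf b_neq0).
  pose k := co a 0 0 2 2 * m ^+ 2 * n ^+ 2.
  suff curve t : 0 <= h * t ^+ 2 + k * t ^+ 4 <= b * m ^+ 2 * n ^+ 2 * t ^+ 4.
    split; [apply: (@lead_ge0 _ k)|
            apply: (@lead_ge0 _ (b * m ^+ 2 * n ^+ 2 - k))] => t;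
      by have /andP[] := curve t; lra.
  (* The direction of the line spans, modulo rescalings of [x] and [y], the
     kernel of the Hessian of [biform] at the zero (e2, e0) or (e1, e2); for
     [b != 0] there is such a kernel exactly when [b] is the corresponding
     bound. *)
  have [bE1|bE2] := bE.
  - have := dom (- t * m) (- t * m * n) 1 1 0 (t * n).
    have -> : biform b m n (- t * m) (- t * m * n) 1 1 0 (t * n)
              = b * m ^+ 2 * n ^+ 2 * t ^+ 4.
      by rewrite /biform bE1; ring.
    suff -> : biquad a (- t * m) (- t * m * n) 1 1 0 (t * n)
              = h * t ^+ 2 + k * t ^+ 4 by [].
    by rewrite /biquad /quad3 !subst_zero !subst_even !subst_la /h bE1 /k; ring.
  - have := dom 0 1 (t * m) (- t * m * n) (- t * n) 1.
    have -> : biform b m n 0 1 (t * m) (- t * m * n) (- t * n) 1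
              = b * m ^+ 2 * n ^+ 2 * t ^+ 4.
      by rewrite /biform bE2; ring.
    suff -> : biquad a 0 1 (t * m) (- t * m * n) (- t * n) 1
              = h * t ^+ 2 + k * t ^+ 4 by [].
    by rewrite /biquad /quad3 !subst_zero !subst_even !subst_la /h bE2 /k; ring.
exists la => x0 x1 x2 y0 y1 y2.
rewrite /biquad /quad3 /biform !subst_zero !subst_even !subst_la a0022.
ring.
Qed.

End Extremality.

(** * Positive maps and their forms *)

Section Maps.
Variable R : realType.

Definition mxform n (A : 'M[R]_n) (x y : 'cV[R]_n) : R := (x^T *m A *m y) 0 0.

Lemma mxformDl n A (x1 x2 y : 'cV[R]_n) :
  mxform A (x1 + x2) y = mxform A x1 y + mxform A x2 y.
Proof. by rewrite /mxform linearD /= !mulmxDl mxE. Qed.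

Lemma mxformDr n A (x y1 y2 : 'cV[R]_n) :
  mxform A x (y1 + y2) = mxform A x y1 + mxform A x y2.
Proof. by rewrite /mxform mulmxDr mxE. Qed.

Lemma mxformZl n A c (x y : 'cV[R]_n) : mxform A (c *: x) y = c * mxform A x y.
Proof. by rewrite /mxform linearZ /= -!scalemxAl mxE. Qed.

Lemma mxformZr n A c (x y : 'cV[R]_n) : mxform A x (c *: y) = c * mxform A x y.
Proof. by rewrite /mxform -scalemxAr mxE. Qed.

Lemma mxformC n (A : 'M[R]_n) x y : A^T = A -> mxform A x y = mxform A y x.
Proof.
move=> AT; rewrite /mxform -(trmxK (x^T *m A *m y)) mxE !trmx_mul trmxK AT.
by rewrite mulmxA.
Qed.

Lemma mxform_delta n (A : 'M[R]_n) i j :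
  mxform A (delta_mx i 0) (delta_mx j 0) = A i j.
Proof. by rewrite /mxform trmx_delta -rowE -colE !mxE. Qed.

Lemma mxform_sub n (A B : 'M[R]_n) x y :
  mxform (A - B) x y = mxform A x y - mxform B x y.
Proof. by rewrite /mxform mulmxBr mulmxBl !mxE. Qed.

Lemma mxform_sum n I (r : seq I) (A : I -> 'M[R]_n) x y :
  mxform (\sum_(i <- r) A i) x y = \sum_(i <- r) mxform (A i) x y.
Proof. by rewrite /mxform mulmx_sumr mulmx_suml summxE. Qed.

Lemma mxform_scale n c (A : 'M[R]_n) x y : mxform (c *: A) x y = c * mxform A x y.
Proof. by rewrite /mxform -scalemxAr -scalemxAl mxE. Qed.

Lemma mxform_rank1 n (u v x y : 'cV[R]_n) :
  mxform (u *m v^T) x y = (x^T *m u) 0 0 * (v^T *m y) 0 0.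
Proof.
by rewrite /mxform !mulmxA -mulmxA [LHS]mxE big_ord1.
Qed.

Lemma psd_diag0 n (A : 'M[R]_n) i j : A^T = A -> psdmx A -> A i i = 0 -> A j i = 0.
Proof.
move=> AT A_ge0 Aii; suff : 2 * A j i = 0 by lra.
apply: (@linear_ge0_eq0 _ _ (A j j)) => t.
have := A_ge0 (delta_mx j 0 + t *: delta_mx i 0); rewrite -/(mxform _ _ _).
rewrite !(mxformDl, mxformDr, mxformZl, mxformZr) !mxform_delta Aii.
have -> : A i j = A j i by rewrite -[in LHS]AT mxE.
lra.
Qed.

(** One step of the Cholesky decomposition; the form of the difference at [x] is
    the value of the form of [A] at the projection of [x] along the basis vector
    [i]. *)
Lemma psd_peel n (A : 'M[R]_n) i : A^T = A -> psdmx A -> 0 < A i i ->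
  psdmx (A - (A i i)^-1 *: (col i A *m (col i A)^T)).
Proof.
move=> AT A_ge0 Aii x; rewrite -/(mxform _ _ _).
set s := mxform A x (delta_mx i 0).
have Aii_neq0 : A i i != 0 by rewrite gt_eqF.
have colE' : x^T *m col i A = (s)%:M.
  by rewrite colE mulmxA [LHS]mx11_scalar.
have -> : mxform (A - (A i i)^-1 *: (col i A *m (col i A)^T)) x x
  = mxform A (x - (s / A i i) *: delta_mx i 0) (x - (s / A i i) *: delta_mx i 0).
  rewrite mxform_sub mxform_scale mxform_rank1.
  rewrite -[(col i A)^T *m x]trmxK trmx_mul trmxK colE' tr_scalar_mx !mxE /= !mulr1n.
  rewrite -!scaleNr !(mxformDl, mxformDr, mxformZl, mxformZr) mxform_delta.
  rewrite -/s (mxformC _ _ AT) -/s; field => //.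
exact: A_ge0.
Qed.

(** Each step annihilates a nonzero diagonal entry and creates no other. *)
Lemma psd_sum_outer n (A : 'M[R]_n) : A^T = A -> psdmx A ->
  exists s : seq 'cV[R]_n, A = \sum_(w <- s) w *m w^T.
Proof.
have [k] := ubnP #|[pred i | A i i != 0]|.
elim: k A => // k IH A; rewrite ltnS => Ak AT A_ge0.
have [/eqP d0|] := boolP (#|[pred i | A i i != 0]| == 0%N).
  exists [::]; rewrite big_nil; apply/matrixP => j i; rewrite mxE.
  apply: psd_diag0 => //; apply/eqP.
  by have := card0_eq d0 i; rewrite inE => /negbFE.
rewrite -lt0n => /card_gt0P [i]; rewrite inE => Aii.
have Aii_gt0 : 0 < A i i.
  by rewrite lt_neqAle eq_sym Aii -mxform_delta; apply: A_ge0.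
set w := (Num.sqrt (A i i))^-1 *: col i A.
have wE : w *m w^T = (A i i)^-1 *: (col i A *m (col i A)^T).
  rewrite /w linearZ /= -scalemxAl -scalemxAr scalerA -invfM -expr2.
  by rewrite sqr_sqrtr // ltW.
have wjk j l : (w *m w^T) j l = A j i * A l i / A i i.
  by rewrite wE !mxE big_ord1 !mxE mulrC.
have [|||s sE] := IH (A - w *m w^T).
- apply: leq_trans Ak; apply: proper_card; apply/properP; split.
    apply/subsetP => j; rewrite !inE mxE [X in _ + X]mxE wjk; apply: contraNneq => Ajj.
    have -> : A j i = A i j by rewrite -[in LHS]AT mxE.
    by rewrite Ajj (psd_diag0 i AT A_ge0 Ajj) // !mul0r subr0.
  by exists i; rewrite !inE // mxE [X in _ + X]mxE wjk mulfK ?subrr ?eqxx.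
- by rewrite linearB /= AT trmx_mul trmxK.
- by rewrite wE; apply: psd_peel.
by exists (w :: s); rewrite big_cons -sE addrC subrK.
Qed.

Lemma sym_trmx n (Z : Sym R n) : (vsval Z)^T = vsval Z.
Proof. by apply/eqP; rewrite -symvE subvsP. Qed.

Lemma psd_sum_outer_sym n (Z : Sym R n) : psdmx (vsval Z) ->
  exists s : seq 'cV[R]_n, Z = \sum_(w <- s) outer w.
Proof.
move=> /(psd_sum_outer (sym_trmx Z)) [s sE]; exists s; apply: val_inj.
by rewrite /= sE raddf_sum.
Qed.

Lemma positive_map_outer n (Psi : 'End(Sym R n)) :
  (forall x y, 0 <= mxform (vsval (Psi (outer x))) y y) -> positive_map Psi.
Proof.
move=> Psi_ge0 Z /psd_sum_outer_sym [s ->] y; rewrite -/(mxform _ _ _).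
rewrite linear_sum raddf_sum mxform_sum sumr_ge0 // => w _; exact: Psi_ge0.
Qed.

Lemma outer_psd n (x : 'cV[R]_n) : psdmx (vsval (outer x)).
Proof.
move=> y; rewrite -/(mxform _ _ _) mxform_rank1.
have -> : (x^T *m y) 0 0 = (y^T *m x) 0 0.
  by rewrite -(trmxK (x^T *m y)) mxE trmx_mul trmxK.
by rewrite -expr2 sqr_ge0.
Qed.

(** By polarization the squares x x^T span, so that a linear map is determined
    by the quadratic forms of its values on them ([end_eq_outer]). *)
Lemma sym_outer_span n (Z : Sym R n) :
  Z = \sum_i \sum_j (vsval Z i j / 2) *:
     (outer (delta_mx i 0 + delta_mx j 0)
      - outer (delta_mx i 0) - outer (delta_mx j 0)).
Proof.
have symE (i j : 'I_n) :
    (delta_mx i 0 + delta_mx j 0) *m (delta_mx i 0 + delta_mx j 0)^T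
    - delta_mx i 0 *m (delta_mx i 0)^T - delta_mx j 0 *m (delta_mx j 0)^T
    = delta_mx i j + delta_mx j i :> 'M[R]_n.
  rewrite linearD /= !trmx_delta mulmxDl !mulmxDr !mul_delta_mx.
  by apply/matrixP => k l; rewrite !mxE; ring.
apply: val_inj; rewrite /= raddf_sum /=.
under eq_bigr => i _.
  rewrite raddf_sum /=; under eq_bigr => j _ do rewrite symE.
  over.
have {1}-> : vsval Z = 2^-1 *: (vsval Z + (vsval Z)^T).
  have half2 : 2^-1 + 2^-1 = 1 :> R by field.
  by rewrite sym_trmx scalerDr -scalerDl half2 scale1r.
rewrite {1}(matrix_sum_delta (vsval Z)) {2}(matrix_sum_delta (vsval Z)).
rewrite raddf_sum -big_split /= scaler_sumr; apply: eq_bigr => i _.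
rewrite raddf_sum -big_split /= scaler_sumr; apply: eq_bigr => j _.
by rewrite linearZ /= trmx_delta -scalerDr scalerA mulrC.
Qed.

Lemma end_eq_outer n (Psi1 Psi2 : 'End(Sym R n)) :
  (forall x y, mxform (vsval (Psi1 (outer x))) y y
               = mxform (vsval (Psi2 (outer x))) y y) ->
  Psi1 = Psi2.
Proof.
move=> eqf.
have eqo x : Psi1 (outer x) = Psi2 (outer x).
  apply/val_inj/matrixP => i j; apply/eqP; rewrite -subr_eq0; apply/eqP.
  have := eqf x (delta_mx i 0 + delta_mx j 0).
  have := eqf x (delta_mx i 0); have := eqf x (delta_mx j 0).
  rewrite !(mxformDl, mxformDr) !mxform_delta.
  have sE (Psi : 'End(Sym R n)) : vsval (Psi (outer x)) j i = vsval (Psi (outer x)) i j.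
    by rewrite -[in LHS]sym_trmx mxE.
  by rewrite !sE; lra.
apply/lfunP => Z; rewrite (sym_outer_span Z) !linear_sum; apply: eq_bigr => i _.
by rewrite !linear_sum; apply: eq_bigr => j _; rewrite !(linearZ, linearB) /= !eqo.
Qed.

Definition vec3 (x0 x1 x2 : R) : 'cV[R]_3 := \col_i [:: x0; x1; x2]`_i.

Lemma vec3E (x : 'cV[R]_3) : x = vec3 (x 0 0) (x 1 0) (x 2 0).
Proof.
apply/matrixP => i j; rewrite ord1 !mxE.
by case: i => [[|[|[|//]]] Hi] /=; congr (x _ _); apply: val_inj.
Qed.

Lemma mxform3 (A : 'M[R]_3) x0 x1 x2 y0 y1 y2 :
  mxform A (vec3 x0 x1 x2) (vec3 y0 y1 y2) =
   x0 * (A 0 0 * y0 + A 0 1 * y1 + A 0 2 * y2)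
   + x1 * (A 1 0 * y0 + A 1 1 * y1 + A 1 2 * y2)
   + x2 * (A 2 0 * y0 + A 2 1 * y1 + A 2 2 * y2).
Proof.
rewrite /mxform !mxE !big_ord_recl big_ord0 !mxE !big_ord_recl !big_ord0 !mxE /=.
have -> : lift ord0 ord0 = 1 :> 'I_3 by apply: val_inj.
have -> : lift ord0 (lift ord0 ord0) = 2 :> 'I_3 by apply: val_inj.
ring.
Qed.

Lemma Phi_biform b m n x0 x1 x2 y0 y1 y2 :
  mxform (vsval (Phi b m n (outer (vec3 x0 x1 x2)))) (vec3 y0 y1 y2) (vec3 y0 y1 y2)
  = biform b m n x0 x1 x2 y0 y1 y2.
Proof.
rewrite PhiE mxform3 !mxE /= !big_ord1 !mxE /= /biform; ring.
Qed.

Lemma mxform_add n (A B : 'M[R]_n) x y :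
  mxform (A + B) x y = mxform A x y + mxform B x y.
Proof. by rewrite /mxform mulmxDr mulmxDl !mxE. Qed.

Lemma mxform_quad3 (A : 'M[R]_3) y0 y1 y2 : A^T = A ->
  mxform A (vec3 y0 y1 y2) (vec3 y0 y1 y2) =
  quad3 (fun k l => A (inord k) (inord l) *+ (k != l).+1) y0 y1 y2.
Proof.
move=> AT.
have inordE (k : 'I_3) : inord k = k :> 'I_3 by apply/val_inj; rewrite /= inordK.
rewrite mxform3 /quad3 (inordE 0) (inordE 1) (inordE 2) !mulr2n.
have -> : A 1 0 = A 0 1 by rewrite -[in LHS]AT mxE.
have -> : A 2 0 = A 0 2 by rewrite -[in LHS]AT mxE.
have -> : A 2 1 = A 1 2 by rewrite -[in LHS]AT mxE.
by rewrite /= !mulr1n; ring.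
Qed.

Lemma outer_vec3 : exists S : nat -> nat -> Sym R 3, forall x0 x1 x2,
  outer (vec3 x0 x1 x2) = x0 ^+ 2 *: S 0%N 0%N + (x0 * x1) *: S 0%N 1%N
  + (x0 * x2) *: S 0%N 2%N + x1 ^+ 2 *: S 1%N 1%N + (x1 * x2) *: S 1%N 2%N
  + x2 ^+ 2 *: S 2%N 2%N.
Proof.
pose e (i : nat) : 'cV[R]_3 := vec3 (i == 0%N)%:R (i == 1%N)%:R (i == 2%N)%:R.
exists (fun i j => if i == j then outer (e i)
                   else outer (e i + e j) - outer (e i) - outer (e j)) => x0 x1 x2.
apply: val_inj; apply/matrixP => i j.
rewrite /= !mxE !big_ord1 !mxE.
by case: i => [[|[|[|//]]] Hi]; case: j => [[|[|[|//]]] Hj] /=; ring.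
Qed.

Lemma end_biquad (Psi : 'End(Sym R 3)) : exists a, forall x0 x1 x2 y0 y1 y2,
  mxform (vsval (Psi (outer (vec3 x0 x1 x2)))) (vec3 y0 y1 y2) (vec3 y0 y1 y2)
  = biquad a x0 x1 x2 y0 y1 y2.
Proof.
have [S SE] := outer_vec3.
exists (fun i j k l => vsval (Psi (S i j)) (inord k) (inord l) *+ (k != l).+1).
move=> x0 x1 x2 y0 y1 y2; rewrite SE !(linearD, linearZ) /=.
rewrite !(mxform_add, mxform_scale) !mxform_quad3 ?sym_trmx // /biquad {7}/quad3.
ring.
Qed.

End Maps.

(** * The maps Phi *)

Section ThePhi.
Variable R : realType.

Lemma biform_Phi b m n (x y : 'cV[R]_3) :
  mxform (vsval (Phi b m n (outer x))) y y
  = biform b m n (x 0 0) (x 1 0) (x 2 0) (y 0 0) (y 1 0) (y 2 0).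
Proof. by rewrite [x in LHS]vec3E [y in LHS]vec3E Phi_biform. Qed.

Lemma Phi_positive (m n b : R) : in_calA m n b -> positive_map (Phi b m n).
Proof.
by move=> A; apply: positive_map_outer => x y; rewrite biform_Phi biform_ge0.
Qed.

Lemma Phi_cp0 (m n : R) : completely_positive (Phi 0 m n).
Proof.
exists 1%N, (fun=> mx3 [:: [:: n; m * n; 0]; [:: - (m * n); m; 0];
                        [:: 0; 0; - (m + n)]]) => x.
rewrite big_ord1 PhiE /Phi_mx scale0r add0r; set B := (X in _ = X *m _ *m _).
rewrite (mulmxA B) -(mulmxA (B *m x)) -trmx_mul [x]vec3E.
move: (x 0 0) (x 1 0) (x 2 0) => x0 x1 x2.
have -> : B *m vec3 x0 x1 x2
    = vec3 (n * (x0 + m * x1)) (- m * (n * x0 - x1)) (- (m + n) * x2).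
  apply/matrixP => i j; rewrite ord1 !mxE !big_ord_recl big_ord0 !mxE.
  by case: i => [[|[|[|//]]] Hi] /=; ring.
apply/matrixP => i j; rewrite !mxE big_ord1 !mxE.
case: i => [[|[|[|//]]] Hi]; case: j => [[|[|[|//]]] Hj];
  rewrite /= ?big_ord1 ?mxE /=; ring.
Qed.

(** A sum of squares vanishes only where all of its terms do. *)
Lemma cp_null n (Psi : 'End(Sym R n)) l (B : 'I_l -> 'M[R]_n) x y :
  (forall x, vsval (Psi (outer x)) = \sum_(i < l) B i *m (x *m x^T) *m (B i)^T) ->
  mxform (vsval (Psi (outer x))) y y = 0 <-> forall i, mxform (B i) y x = 0.
Proof.
move=> PsiE.
have -> : mxform (vsval (Psi (outer x))) y y = \sum_(i < l) mxform (B i) y x ^+ 2.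
  rewrite PsiE mxform_sum; apply: eq_bigr => i _.
  rewrite (mulmxA (B i)) -(mulmxA (B i *m x)) -trmx_mul mxform_rank1.
  rewrite expr2 /mxform mulmxA; congr (_ * _).
  by rewrite -[(B i *m x)^T *m y]trmxK trmx_mul trmxK mxE mulmxA.
split=> [/eqP|B0]; last by rewrite big1 // => i _; rewrite B0 expr0n.
rewrite psumr_eq0 => [/allP s0 i|i _]; last exact: sqr_ge0.
by apply/eqP; rewrite -sqrf_eq0; apply: (s0 i); rewrite mem_index_enum.
Qed.

Lemma Phi_not_cp (m n b : R) : b <> 0 -> ~ completely_positive (Phi b m n).
Proof.
move=> b_neq0 [l [B BE]]; apply: b_neq0.
have null x0 x1 x2 y0 y1 y2 : biform b m n x0 x1 x2 y0 y1 y2 = 0 <->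
    forall i, mxform (B i) (vec3 y0 y1 y2) (vec3 x0 x1 x2) = 0.
  by rewrite -Phi_biform; apply: cp_null.
have -> : b = biform b m n 0 0 1 0 1 0 by rewrite /biform; ring.
apply: (null _ _ _ _ _ _).2 => i.
have h1 : mxform (B i) (vec3 0 0 1) (vec3 0 1 0) = 0.
  by apply: (null _ _ _ _ _ _).1; rewrite /biform; ring.
have diag s t : let e := vec3 ((-1) ^+ nat_of_bool s) ((-1) ^+ nat_of_bool t) 1 in
    mxform (B i) e e = 0.
  apply: (null _ _ _ _ _ _).1; rewrite /biform.
  by case: s t => [] [] /=; rewrite ?expr0 ?expr1; ring.
move: (diag false false) (diag false true) (diag true false) (diag true true).
by move: h1; rewrite /= ?expr0 ?expr1 !mxform3; lra.
Qed.

(** Off [m = n = 0], where the map vanishes, [m] and [n] have opposite signs. *)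
Lemma calA_degenerate (m n b : R) : in_calA m n b -> m * n = 0 -> m = 0 /\ n = 0.
Proof.
move=> /and4P[_ _ _ /andP[b0]]; rewrite /bmax le_min => /andP[bn bm] mn.
have [m2 n2] := (sqr_ge0 m, sqr_ge0 n).
have mn2 : m ^+ 2 * n ^+ 2 = 0 by rewrite -exprMn mn expr0n.
have mn2' : 2 * m * n = 0 by rewrite -mulrA mn mulr0.
rewrite mn2 mn2' in bn bm.
by split; apply/eqP; rewrite -sqrf_eq0; apply/eqP; lra.
Qed.

Lemma Phi_face (m n b : R) (Psi1 Psi2 : 'End(Sym R 3)) :
  in_calA m n b -> b = bmax m n -> positive_map Psi1 -> positive_map Psi2 ->
  Phi b m n = Psi1 + Psi2 -> exists la, Psi1 = la *: Phi b m n.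
Proof.
move=> A bE Psi1_ge0 Psi2_ge0 PhiE.
have [a aE] := end_biquad Psi1.
have dom x0 x1 x2 y0 y1 y2 : 0 <= biquad a x0 x1 x2 y0 y1 y2
                               <= biform b m n x0 x1 x2 y0 y1 y2.
  rewrite -aE -Phi_biform PhiE add_lfunE /= mxform_add.
  rewrite lerDl; apply/andP; split.
    exact: Psi1_ge0 _ (outer_psd _) _.
  exact: Psi2_ge0 _ (outer_psd _) _.
suff [la laE] : exists la, forall x0 x1 x2 y0 y1 y2,
    biquad a x0 x1 x2 y0 y1 y2 = la * biform b m n x0 x1 x2 y0 y1 y2.
  exists la; apply: end_eq_outer => x y; rewrite [x]vec3E [y]vec3E aE laE -Phi_biform.
  by rewrite scale_lfunE /= mxform_scale.
have [/eqP mn0|mn_neq0] := boolP (m * n == 0).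
  have [m0 n0] := calA_degenerate A mn0.
  exists 0 => x0 x1 x2 y0 y1 y2; rewrite mul0r; apply/eqP; rewrite eq_le andbC.
  have := dom x0 x1 x2 y0 y1 y2.
  have -> // : biform b m n x0 x1 x2 y0 y1 y2 = 0.
  rewrite /biform bE /bmax m0 n0 !(mulr0, mul0r, expr0n) /= !addr0 oppr0 minxx; ring.
move: mn_neq0; rewrite mulf_eq0 negb_or => /andP[m0 n0].
have /and4P[_ _ _ /andP[b0 _]] := A.
apply: biform_face m0 n0 b0 _ dom.
by rewrite bE /bmax; case: leP => _; [left|right].
Qed.

Lemma Phi_extremal (m n b : R) :
  in_calA m n b -> b = bmax m n -> extremal_positive (Phi b m n).
Proof.
move=> A bE; split; first exact: Phi_positive.
move=> [Psi1 [Psi2 [pos1 pos2 fr PhiE]]].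
have [la Psi1E] := Phi_face A bE pos1 pos2 PhiE.
have [mu Psi2E] := Phi_face A bE pos2 pos1 (etrans PhiE (addrC _ _)).
move: fr; rewrite Psi1E Psi2E free_cons span_seq1 seq1_free => /andP[] + nz.
have mu_neq0 : mu != 0 by apply: contraNneq nz => ->; rewrite scale0r.
by rewrite -[la](divfK mu_neq0) -scalerA memvZ ?memv_line.
Qed.

End ThePhi.

Theorem theorem8 (R : realType) :
  (forall m n b : R, in_calA m n b -> positive_map (Phi b m n)) /\
  (forall m n b : R, in_calA m n b ->
     (b = 0 -> completely_positive (Phi b m n)) /\
     (b <> 0 -> ~ completely_positive (Phi b m n))) /\
  (forall m n b : R, in_calA m n b -> b = bmax m n ->
     extremal_positive (Phi b m n)).
Proof.
split; [exact: Phi_positive|split; last exact: Phi_extremal].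
move=> m n b _; split; [by move=> ->; apply: Phi_cp0|exact: Phi_not_cp].
Qed.
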